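(* If $T$ is a non-trivial subdivision tree (over $S_2$), then $N(T)=[m,M]\cap\mathbb{Z}$, where $m=\min(N(T))$ and $M=\max(N(T))$.
   Context: Let $I=[0,1)$; $A:I\to[0,1/2)$, $A(x)=\frac{x}{x+1}$; $B:I\to[1/2,1)$, $B(x)=\frac1{2-x}$; $C=C_2:I\to I$, $C(x)=\frac{2x}{x+1}$. A subdivision tree is a finite rooted binary tree, each vertex of which is either a leaf (no children) or a node (having a left child and a right child), together with a label in $\mathbb{Z}$ on each node. The trivial subdivision tree consists of a single vertex, which is a leaf. Each leaf $\ell$ is labelled by a word: if the path from the root to $\ell$ passes through nodes with labels $n_1,\dots,n_k$ (in order, starting at the root) and $X_j=A$ (resp. $X_j=B$) if the path goes from the $j$-th node to its left (resp. right) child, then the label of $\ell$ is $C^{n_1}X_1C^{n_2}X_2\cdots C^{n_k}X_k$. As a tree over $S_2$, the tree represents the collection of intervals $\omega\cdot[0,1)$, where $\omega$ ranges over the leaf labels, read as compositions of functions (rightmost applied first); this is a partition of $[0,1)$. Two subdivision trees are equivalent, $T_1\approx T_2$, if they represent the same collection of intervals. For non-trivial $T$, $n(T)$ is the integer label of the root, and $N(T)=\{n(T')\mid T'\approx T\}$ (a finite set). *)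

(* Defs.v *)
From HB Require Import structures.
From mathcomp Require Import all_boot all_order all_algebra.
From mathcomp Require Import ring lra.
From mathcomp Require Import mathcomp_extra boolp classical_sets functions.
From mathcomp Require Import set_interval reals.
Set Implicit Arguments.
Unset Strict Implicit.
Unset Printing Implicit Defensive.
Import Order.TTheory GRing.Theory Num.Theory.
Local Open Scope classical_set_scope.
Local Open Scope ring_scope.

(* Maps of I = [0, 1) are represented by total maps of R; only their values   *)
(* on unitI are ever used.                                                    *)
Definition unitI {R : realType} : set R := `[0, 1[%classic.

Definition mapA {R : realType} (x : R) : R := x / (x + 1).
Definition mapB {R : realType} (x : R) : R := 1 / (2 - x).
Definition mapC {R : realType} (x : R) : R := 2 * x / (x + 1).
(* The inverse of the bijection mapC of unitI: see mapCK and mapCinvK.        *)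
Definition mapCinv {R : realType} (x : R) : R := x / (2 - x).

Definition powC {R : realType} (n : int) : R -> R :=
  match n with
  | Posz k => iter k mapC
  | Negz k => iter k.+1 mapCinv
  end.

Inductive letter : Type := LA | LB | LC of int.

Definition letter_map {R : realType} (a : letter) : R -> R :=
  match a with
  | LA => mapA
  | LB => mapB
  | LC n => powC n
  end.

(* The rightmost letter is applied first.                                     *)
Definition word_map {R : realType} (w : seq letter) : R -> R :=
  foldr (fun a f => letter_map a \o f) id w.

Inductive subdivision_tree : Type :=
  | Leaf
  | Node of int & subdivision_tree & subdivision_tree.

Fixpoint leaf_labels (T : subdivision_tree) : set (seq letter) :=
  match T with
  | Leaf => [set [::]]
  | Node n l r =>
      [set [:: LC n, LA & w] | w in leaf_labels l] `|`
      [set [:: LC n, LB & w] | w in leaf_labels r]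
  end.

Definition intervals (R : realType) (T : subdivision_tree) : set (set R) :=
  [set word_map w @` unitI | w in leaf_labels T].
Arguments intervals : clear implicits.

Definition tree_equiv (R : realType) (T1 T2 : subdivision_tree) : Prop :=
  intervals R T1 = intervals R T2.

Definition root_label (T : subdivision_tree) : option int :=
  match T with
  | Leaf => None
  | Node n _ _ => Some n
  end.

Definition root_labels (R : realType) (T : subdivision_tree) : set int :=
  [set n | exists T', tree_equiv R T' T /\ root_label T' = Some n].

Definition is_min (S : set int) (m : int) : Prop := S m /\ lbound S m.
Definition is_max (S : set int) (M : int) : Prop := S M /\ ubound S M.

Lemma unitIE (R : realType) (x : R) : unitI x <-> 0 <= x < 1.
Proof. by rewrite /unitI /= in_itv. Qed.

Lemma mapA_unitI (R : realType) (x : R) : unitI x -> 0 <= mapA x < 1 / 2.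
Proof.
move=> /unitIE /andP[x0 x1]; have p : 0 < x + 1 by lra.
by rewrite /mapA ler_pdivlMr // ltr_pdivrMr //; apply/andP; split; lra.
Qed.

Lemma mapB_unitI (R : realType) (x : R) : unitI x -> 1 / 2 <= mapB x < 1.
Proof.
move=> /unitIE /andP[x0 x1]; have p : 0 < 2 - x by lra.
by rewrite /mapB ler_pdivlMr // ltr_pdivrMr //; apply/andP; split; lra.
Qed.

Lemma mapC_unitI (R : realType) (x : R) : unitI x -> unitI (mapC x).
Proof.
move=> /unitIE /andP[x0 x1]; have p : 0 < x + 1 by lra.
apply/unitIE; rewrite /mapC ler_pdivlMr // ltr_pdivrMr //.
by apply/andP; split; lra.
Qed.

Lemma mapCinv_unitI (R : realType) (x : R) : unitI x -> unitI (mapCinv x).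
Proof.
move=> /unitIE /andP[x0 x1]; have p : 0 < 2 - x by lra.
apply/unitIE; rewrite /mapCinv ler_pdivlMr // ltr_pdivrMr //.
by apply/andP; split; lra.
Qed.

Lemma mapCK (R : realType) (x : R) : unitI x -> mapCinv (mapC x) = x.
Proof.
move=> /unitIE /andP[x0 x1]; rewrite /mapCinv /mapC; field.
by apply/andP; split; apply: lt0r_neq0; lra.
Qed.

Lemma mapCinvK (R : realType) (x : R) : unitI x -> mapC (mapCinv x) = x.
Proof.
move=> /unitIE /andP[x0 x1]; rewrite /mapCinv /mapC; field.
by apply/andP; split; apply: lt0r_neq0; lra.
Qed.

(* Main.v *)
(* In the coordinate t = x / (1 - x), the maps A, B, C are t / (1 + t), t + 1 and
   2 t, so a subdivision tree is a triangulation of an ideal polygon with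
   vertices in [0, oo] whose sides and diagonals are Farey edges over Z[1/2]
   (determinant a power of 2), and the root triangle is (0, 2^n, oo).

   Colour a rational by the parity of its numerator: 0 and oo get different
   colours, and the colour of 2^n tells whether n <= 0.  A bicoloured edge has
   odd determinant, hence is an ordinary Farey edge, and ordinary Farey edges do
   not cross.  Suppose that two equivalent trees have roots n <= 0 and n' >= 1.
   From the root edge, follow in each tree the triangles whose majority colour
   is that of the root triangle; they fill two polygons.  The sides of their
   intersection are bicoloured, because a side of the given polygon belonging to
   both has endpoints of both colours.  So the intersection is an ordinary Farey
   polygon; it contains the mediant 1 of 0 and oo and has a Farey triangulation,
   which either of the two trees extends outside it to a triangulation with root
   label 0.  Conjugating by powers of C shows that the root labels form a convex
   set; it is finite because 2^n is a breakpoint. *)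
Require Import Defs.
From HB Require Import structures.
From mathcomp Require Import all_boot all_order all_algebra.
From mathcomp Require Import ring lra zify.
From mathcomp Require Import mathcomp_extra boolp classical_sets functions.
From mathcomp Require Import set_interval reals.
Set Implicit Arguments.
Unset Strict Implicit.
Unset Printing Implicit Defensive.
Import Order.TTheory GRing.Theory Num.Theory.
Local Open Scope classical_set_scope.
Local Open Scope ring_scope.

(** * Farey determinants, edges and parities *)

(** The value is the same in the coordinate [t], because [x = t / (1 + t)] comes from an integral
    matrix of determinant 1. *)
Definition fdet (x y : rat) : int := numq y * denq x - numq x * denq y.

Definition edge (x y : rat) : Prop := exists k : nat, fdet x y = 2 ^+ k.

(* [x = t / (1 + t)] has the same numerator as [t]. *)
Definition colour (x : rat) : bool := odd `|numq x|.

Lemma fdet_gt0 x y : (0 < fdet x y) = (x < y).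
Proof.
rewrite /fdet subr_gt0 -[X in _ = (X < _)]divq_num_den.
rewrite -[X in _ = (_ < X)]divq_num_den.
rewrite ltr_pdivrMr ?ltr0z ?denq_gt0 // mulrAC ltr_pdivlMr ?ltr0z ?denq_gt0 //.
by rewrite -!intrM ltr_int.
Qed.

Lemma edge_lt x y : edge x y -> x < y.
Proof. by case=> k e; rewrite -fdet_gt0 e exprn_gt0. Qed.

(** The denominator beside the even numerator is odd by coprimality, so exactly one of the two
    products in [fdet x y] is odd; the only odd power of 2 is 1. *)
Lemma edge_bicoloured x y : edge x y -> colour x != colour y -> fdet x y = 1.
Proof.
case=> -[|k] // e; rewrite /colour => c.
have cx := coprime_num_den x; have cy := coprime_num_den y.
have /(congr1 (fun z => odd `|z|%N)) : numq y * denq x = numq x * denq y + 2 ^+ k.+1.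
  by rewrite -e /fdet; ring.
suff : odd `|numq y * denq x| != odd `|numq x * denq y + 2 ^+ k.+1|.
  by move=> /eqP.
have -> : odd `|numq x * denq y + 2 ^+ k.+1| = odd `|numq x * denq y|.
  rewrite exprS; lia.
rewrite !abszM !oddM.
case ox : (odd `|numq x|) c => /=; case oy : (odd `|numq y|) => //= _.
  suff -> : odd `|denq y| by [].
  apply: contraTT cy => ody; rewrite /coprime; apply/eqP => g.
  have : (2 %| gcdn `|numq y| `|denq y|)%N by rewrite dvdn_gcd !dvdn2 oy ody.
  by rewrite g.
suff -> : odd `|denq x| by [].
apply: contraTT cx => ody; rewrite /coprime; apply/eqP => g.
have : (2 %| gcdn `|numq x| `|denq x|)%N by rewrite dvdn_gcd !dvdn2 ox ody.
by rewrite g.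
Qed.

(** The vector of [z] is the combination of those of [x] and [y] with coefficients [fdet z y] and
    [fdet x z], which are positive integers. *)
Lemma farey_between x y z :
  fdet x y = 1 -> x < z -> z < y -> denq x + denq y <= denq z.
Proof.
move=> e; rewrite -!fdet_gt0 => xz zy.
have -> : denq z = fdet z y * denq x + fdet x z * denq y.
  by rewrite -[LHS]mulr1 -e /fdet; ring.
by have := denq_gt0 x; have := denq_gt0 y; nia.
Qed.

(** By [farey_between], each of [a] and [y] would have a larger denominator than the other. *)
Lemma farey_noncrossing x y a b :
  fdet x y = 1 -> fdet a b = 1 -> x < a -> a < y -> y < b -> False.
Proof.
move=> exy eab xa ay yb.
have := farey_between exy xa ay; have := farey_between eab ay yb.
by have := denq_gt0 x; have := denq_gt0 b; lia.
Qed.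

(** * Triangulations over a segment and chains of sides *)

(** [P] is the vertex set of the polygon; what is triangulated is its part over the segment from [x]
    to [y]. *)
Inductive triangulated (P : pred rat) : rat -> rat -> Prop :=
| triangulated_side x y : (forall z, x < z -> z < y -> ~~ P z) ->
    triangulated P x y
| triangulated_apex x w y : P w -> edge x w -> edge w y ->
    triangulated P x w -> triangulated P w y -> triangulated P x y.

Inductive chain (Q : rat -> rat -> Prop) : nat -> rat -> rat -> Prop :=
| chain_nil x : chain Q 0 x x
| chain_cons n x w y : Q x w -> chain Q n w y -> chain Q n.+1 x y.

Lemma chain_cat Q n m x y z :
  chain Q n x y -> chain Q m y z -> chain Q (n + m) x z.
Proof.
elim=> [//|k a w b q _ IH] /IH h; rewrite addSn; exact: chain_cons q h.
Qed.

Lemma chain_sub Q Q' n x y :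
  (forall a b, Q a b -> Q' a b) -> chain Q n x y -> chain Q' n x y.
Proof.
by move=> h; elim=> [a|k a w b /h q _]; [exact: chain_nil|exact: chain_cons q].
Qed.

Lemma chain_le Q n x y :
  (forall a b, Q a b -> a < b) -> chain Q n x y -> x <= y.
Proof. by move=> h; elim=> [//|k a w b /h/ltW q _]; exact: le_trans. Qed.

Lemma chain_lt Q n x y : (forall a b, Q a b -> a < b) -> (0 < n)%N ->
  chain Q n x y -> x < y.
Proof.
move=> h n_gt0 c; inversion c as [|k ? w ? q c']; subst; first by [].
exact: lt_le_trans (h _ _ q) (chain_le h c').
Qed.

Lemma chain_bounds Q n x y : (forall a b, Q a b -> a < b) ->
  chain Q n x y -> chain (fun a b => [/\ Q a b, x <= a & b <= y]) n x y.
Proof.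
move=> h; elim=> [a|k a w b q c IH]; first exact: chain_nil.
apply: (@chain_cons _ _ _ w); first by split=> //; exact: chain_le h c.
by apply: chain_sub IH => s t [? ws ?]; split=> //; apply: le_trans ws; exact/ltW/h.
Qed.

Lemma chain_cut Q n x y z : (forall a b, Q a b -> a < b) ->
  chain Q n x y -> x <= z -> z <= y ->
  (exists n1 n2, [/\ n = (n1 + n2)%N, chain Q n1 x z & chain Q n2 z y]) \/
  (exists a b, [/\ Q a b, x <= a, b <= y, a < z & z < b]).
Proof.
move=> h; elim=> [a az za|k a w b q c IH az zb].
  have -> : z = a by apply/eqP; rewrite eq_le az za.
  by left; exists 0%N, 0%N; split=> //; exact: chain_nil.
have [wz|zw] := leP w z.
  have [[n1 [n2 [-> c1 c2]]]|[s [t [st ws tb sz zt]]]] := IH wz zb.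
    by left; exists n1.+1, n2; split=> //; exact: chain_cons c1.
  right; exists s, t; split=> //; apply: le_trans ws; exact/ltW/h.
move: az; rewrite le_eqVlt => /orP[/eqP <-|az].
  by left; exists 0%N, k.+1; split=> //; [exact: chain_nil|exact: chain_cons c].
by right; exists a, w; split=> //; exact: chain_le h c.
Qed.

Lemma chain_proper Q n x y : (forall a b, Q a b -> a < b) -> (1 < n)%N ->
  chain Q n x y -> chain (fun a b => Q a b /\ ~ (a = x /\ b = y)) n x y.
Proof.
move=> h n1 c; inversion c as [|k ? w ? q c']; subst; first by [].
have xw := h _ _ q.
apply: (@chain_cons _ _ _ w).
  split=> // -[_ wy]; subst w.
  inversion c' as [|? ? w' ? q' c'']; subst; first by [].
  by have := lt_le_trans (h _ _ q') (chain_le h c''); rewrite ltxx.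
apply: chain_sub (chain_bounds h c') => a b [qab wa _]; split=> // -[ax _].
by move: wa; rewrite ax leNgt xw.
Qed.

Lemma mediant_exists x y : fdet x y = 1 -> exists w,
  [/\ denq w = denq x + denq y, x < w, w < y, fdet x w = 1 & fdet w y = 1].
Proof.
move=> f; pose n := numq x + numq y; pose d := denq x + denq y.
have d_gt0 : 0 < d by rewrite addr_gt0.
have cop : coprime `|n| `|d|.
  rewrite -/(coprimez n d); apply/coprimezP.
  (* The Bezout combination with these coefficients equals [fdet x y]. *)
  by exists (denq x, - numq x); rewrite /= -f /fdet /n /d; ring.
pose w : rat := n%:~R / d%:~R.
have nw : numq w = n by rewrite coprimeq_num // gtr0_sg // mul1r.
have dw : denq w = d by rewrite coprimeq_den // gt_eqF // gtr0_norm.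
have f1 : fdet x w = 1 by rewrite -f /fdet nw dw /n /d; ring.
have f2 : fdet w y = 1 by rewrite -f /fdet nw dw /n /d; ring.
by exists w; split=> //; rewrite -fdet_gt0 ?f1 ?f2.
Qed.

(** * Merging the boundaries of two majority-coloured polygons *)

Section Chains.
Variable P : pred rat.

(* The sides of a connected union of triangles of which most vertices have
   colour [c]: each is a side of the polygon, or is bicoloured. *)
Definition majority_side (c : bool) (a b : rat) : Prop :=
  [/\ P a && P b, edge a b, triangulated P a b,
      (forall z, a < z -> z < b -> ~~ P z) \/ colour a != colour b &
      (colour a == c) || (colour b == c)].

(** These are the sides of the intersection of the two polygons; the triangulation over each of them
    is reused unchanged. *)
Definition bicoloured_side (a b : rat) : Prop :=
  [/\ P a && P b, fdet a b = 1, triangulated P a b & colour a != colour b].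

Lemma majority_side_lt c a b : majority_side c a b -> a < b.
Proof. by case=> _ /edge_lt. Qed.

Lemma bicoloured_side_lt a b : bicoloured_side a b -> a < b.
Proof. by case=> _ e _ _; rewrite -fdet_gt0 e. Qed.

(** The descent passes through a triangle as long as its majority colour is [c]. Where it stops at a
    triangle, [w] and one of [x], [y] have the other colour, so [x y] is bicoloured. *)
Lemma majority_chain c x y : triangulated P x y -> P x -> P y -> edge x y ->
  (colour x == c) || (colour y == c) -> exists n, chain (majority_side c) n x y.
Proof.
elim=> {x y} [x y h|x w y Pw exw ewy t1 IH1 t2 IH2] Px Py exy cxy.
  exists 1%N; apply: chain_cons (chain_nil _ _).
  by split=> //; [rewrite Px|exact: triangulated_side|left].
(* As [x] or [y] has colour [c], this condition says that at least two of the three vertices do. *)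
have [h|h] := boolP ((colour w == c) || (colour x == colour y)).
  have [|n1 c1] := IH1 Px Pw exw.
    by move: h cxy; clear; case: (colour x) (colour y) (colour w) c => [] [] [] [].
  have [|n2 c2] := IH2 Pw Py ewy.
    by move: h cxy; clear; case: (colour x) (colour y) (colour w) c => [] [] [] [].
  by exists (n1 + n2)%N; exact: chain_cat c1 c2.
exists 1%N; apply: chain_cons (chain_nil _ _).
split=> //; [by rewrite Px|exact: triangulated_apex Pw _ _ _ _|right].
by move: h; rewrite negb_or => /andP[].
Qed.

(* The merged chain consists of the maximal intervals of both chains; two
   sides cannot overlap partially, since then both would be bicoloured. *)
Lemma merge_chains c n m x y :
  chain (majority_side c) n x y -> chain (majority_side (~~ c)) m x y ->
  exists2 k, chain bicoloured_side k x y & (1 < n -> 1 < m -> 1 < k)%N.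
Proof.
(* Induction on the total number of sides, for all [c] because the two chains exchange roles. *)
move: {2}(n + m)%N (leqnn (n + m)) => N.
elim: N c n m x => [|N IH] c n m x.
  rewrite leqn0 addn_eq0 => /andP[/eqP-> _] c1 _; inversion c1; subst.
  by exists 0%N => //; exact: chain_nil.
move=> nm c1 c2; inversion c1 as [x1 E1 E2 E3|k x1 d y1 q1 r1 E1 E2 E3]; subst.
  by exists 0%N => //; exact: chain_nil.
inversion c2 as [x1 E1 E2 E3|k' x1 d' y1 q2 r2 E1 E2 E3]; subst.
  have := chain_le (@majority_side_lt c) r1; have := majority_side_lt q1.
  by move=> h /(lt_le_trans h); rewrite ltxx.
(* The longer first side [x d2] is kept: it is bicoloured because the vertex [d1] lies inside it,
   and the other chain passes through [d2] because a side over [d2] would cross it. *)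
have nested c' k1 k2 d1 d2 : (k1.+1 + k2.+1 <= N.+1)%N -> d1 < d2 ->
    majority_side c' x d1 -> chain (majority_side c') k1 d1 y ->
    majority_side (~~ c') x d2 -> chain (majority_side (~~ c')) k2 d2 y ->
    exists2 k, chain bicoloured_side k x y & (0 < k2 -> 1 < k)%N.
  move=> le d12 s1 t1 s2 t2.
  have xd1 := majority_side_lt s1.
  have d2y := chain_le (@majority_side_lt _) t2.
  have [Px2 e2 tr2 [h|col2] _] := s2.
    have [/andP[_ Pd1] _ _ _ _] := s1.
    by have := h d1 xd1 d12; rewrite Pd1.
  have f2 := edge_bicoloured e2 col2.
  have [|[a [b [sab d1a bd2 ad2 d2b]]]] :=
      chain_cut (@majority_side_lt _) t1 (ltW d12) d2y.
    case=> n1 [n2 [E _ t3]]; have [|k3 r3 _] := IH c' _ _ _ _ t3 t2.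
      by lia.
    exists k3.+1 => [|k2_gt0]; first by apply: chain_cons r3.
    have := chain_lt (@majority_side_lt _) k2_gt0 t2.
    by case: k3 r3 => // r3; inversion r3; rewrite ltxx.
  have [_ eab _ [h|colab] _] := sab.
    by have /andP[_ Pd2] := Px2; have := h d2 ad2 d2b; rewrite Pd2.
  have [] := farey_noncrossing f2 (edge_bicoloured eab colab) _ ad2 d2b.
  exact: lt_le_trans d1a.
have [dd|dd|dd] := ltgtP d d'.
- by have [k3 r3 h] := nested c k k' d d' nm dd q1 r1 q2 r2; exists k3.
- move: (nested (~~ c) k' k d' d); rewrite negbK addnC => /(_ nm dd q2 r2 q1 r1).
  by case=> k3 r3 h; exists k3 => // /h.
- subst d'; have [|k3 r3 _] := IH c k k' _ _ r1 r2; first by lia.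
  exists k3.+1 => [|k_gt0 _]; last first.
    have := chain_lt (@majority_side_lt _) k_gt0 r1.
    by case: k3 r3 => // r3; inversion r3; rewrite ltxx.
  (* A side common to both chains has one endpoint of colour [c] and one of colour [~~ c]. *)
  have [Pxd ed td _ h1] := q1; have [_ _ _ _ h2] := q2.
  have col : colour x != colour d.
    by move: h1 h2; clear; case: (colour x) (colour d) c => [] [] [].
  by apply: chain_cons r3; split=> //; exact: edge_bicoloured.
Qed.

(** A side [a b] with [w] strictly inside satisfies [denq a + denq b <= denq w]. Unless it is [x y],
    it has an endpoint strictly between [x] and [y], whose denominator is at least [denq w]. *)
Lemma mediant_vertex n x y w : fdet x y = 1 -> denq w = denq x + denq y ->
  x < w -> w < y -> (1 < n)%N -> chain bicoloured_side n x y ->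
  exists n1 n2, [/\ (n1 < n)%N, (n2 < n)%N,
    chain bicoloured_side n1 x w & chain bicoloured_side n2 w y].
Proof.
move=> f ew xw wy n1 c0.
have := chain_cut (fun a b (q : _ /\ _) => bicoloured_side_lt q.1)
  (chain_proper bicoloured_side_lt n1 c0) (ltW xw) (ltW wy).
case=> [[m1 [m2 [-> c1 c2]]]|[a [b [[s ne] xa b_y aw wb]]]].
  have m1_gt0 : (0 < m1)%N.
    by case: m1 c1 {n1 c0} => // c1; inversion c1; subst; rewrite ltxx in xw.
  have m2_gt0 : (0 < m2)%N.
    by case: m2 c2 {n1 c0} => // c2; inversion c2; subst; rewrite ltxx in wy.
  exists m1, m2; split; [by lia|by lia| |].
    by apply: chain_sub c1 => ? ? [].
  by apply: chain_sub c2 => ? ? [].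
have [_ fab _ _] := s.
have := farey_between fab aw wb; have := denq_gt0 a; have := denq_gt0 b.
move: xa; rewrite le_eqVlt => /orP[/eqP ax|xa].
  move: b_y; rewrite le_eqVlt => /orP[/eqP b_y|b_y]; first by case: ne.
  by have := farey_between f (lt_trans xw wb) b_y; lia.
by have := farey_between f xa (lt_trans aw wy); lia.
Qed.

Lemma bicoloured_chain_start n x y : x < y -> chain bicoloured_side n x y -> P x.
Proof.
move=> xy c; inversion c as [|k ? w ? q c']; subst; first by rewrite ltxx in xy.
by case: q => /andP[].
Qed.

(** Splitting at mediants, which are vertices of the chain, gives the Farey triangulation down to
    single sides, each of which carries its own triangulation. *)
Lemma bicoloured_chain_triangulated n x y : fdet x y = 1 ->
  chain bicoloured_side n x y -> triangulated P x y.
Proof.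
elim/ltn_ind: n x y => n IH x y f c.
have xy : x < y by rewrite -fdet_gt0 f.
have [n1|] := ltnP 1 n; last first.
  case: n c {IH} => [|[|//]] c _.
    by inversion c; subst; rewrite ltxx in xy.
  inversion c as [|? ? w ? [_ _ t _] c']; subst.
  by inversion c'; subst.
have [w [ew xw wy f1 f2]] := mediant_exists f.
have [m1 [m2 [l1 l2 c1 c2]]] := mediant_vertex f ew xw wy n1 c.
apply: (@triangulated_apex _ _ w); last 2 first.
- exact: IH l1 _ _ f1 c1.
- exact: IH l2 _ _ f2 c2.
- exact: bicoloured_chain_start c2.
- by exists 0%N.
- by exists 0%N.
Qed.

(** The triangles on [x y] with apices [u] and [v] have different majority colours. Both chains are
    split at their apex, so the merged chain has at least two sides and the mediant is one of its
    vertices. *)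
Lemma mediant_apex x y u v w : P x -> P y -> fdet x y = 1 ->
  colour x != colour y ->
  P u -> colour u = colour x -> edge x u -> edge u y ->
  triangulated P x u -> triangulated P u y ->
  P v -> colour v = colour y -> edge x v -> edge v y ->
  triangulated P x v -> triangulated P v y ->
  x < w -> w < y -> denq w = denq x + denq y ->
  fdet x w = 1 -> fdet w y = 1 ->
  [/\ P w, triangulated P x w & triangulated P w y].
Proof.
move=> Px Py f cxy Pu cu xu uy txu tuy Pv cv xv vy txv tvy xw wy dw f1 f2.
have chain_through z : P z -> edge x z -> edge z y -> triangulated P x z ->
    triangulated P z y ->
    exists2 n, chain (majority_side (colour z)) n x y & (1 < n)%N.
  move=> Pz xz zy txz tzy.
  have [|n1 c1] := majority_chain (c := colour z) txz Px Pz xz.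
    by rewrite eqxx orbT.
  have [|n2 c2] := majority_chain (c := colour z) tzy Pz Py zy.
    by rewrite eqxx.
  exists (n1 + n2)%N; first exact: chain_cat c1 c2.
  case: n1 c1 => [|n1] c1.
    by inversion c1; subst; have := edge_lt xz; rewrite ltxx.
  case: n2 c2 => [|n2] c2; last by rewrite addSn addnS.
  by inversion c2; subst; have := edge_lt zy; rewrite ltxx.
have [n1 c1 n1_gt1] := chain_through u Pu xu uy txu tuy.
have [n2 c2 n2_gt1] := chain_through v Pv xv vy txv tvy.
have Ev : colour v = ~~ colour u.
  by rewrite cu cv; case: (colour x) (colour y) cxy => [] [].
rewrite Ev in c2.
have [k c3 /(_ n1_gt1 n2_gt1) k_gt1] := merge_chains c1 c2.
have [m1 [m2 [_ _ d1 d2]]] := mediant_vertex f dw xw wy k_gt1 c3.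
split; first exact: bicoloured_chain_start d2.
- exact: bicoloured_chain_triangulated d1.
- exact: bicoloured_chain_triangulated d2.
Qed.

End Chains.

(** * Breakpoints of a tree in homogeneous coordinates *)

Definition vratio (u : rat * rat) : rat := u.1 / u.2.
Definition scale2 (n : int) (v : rat * rat) : rat * rat :=
  (2 ^ n * v.1, 2 ^ n * v.2).
(** Composing on the right with [powC n] scales the second vector by [2 ^ n]; then [mapA] replaces
    the second vector, and [mapB] the first, by the sum of the two. *)
Definition mid (n : int) (u v : rat * rat) : rat * rat :=
  (u.1 + 2 ^ n * v.1, u.2 + 2 ^ n * v.2).

(* The pair [(u, v)] of vectors encodes the projective map sending the points
   0 and 1 of the closed interval to [vratio u] and [vratio v], and 1/2 to
   [vratio (mid 0 u v)]. *)
Fixpoint breakpoints (T : subdivision_tree) (u v : rat * rat) : seq rat :=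
  if T is Node n l r then
    breakpoints l u (mid n u v) ++
      vratio (mid n u v) :: breakpoints r (mid n u v) (scale2 n v)
  else [::].

Fixpoint gaps (T : subdivision_tree) (u v : rat * rat) : seq (rat * rat) :=
  if T is Node n l r then
    gaps l u (mid n u v) ++ gaps r (mid n u v) (scale2 n v)
  else [:: (vratio u, vratio v)].

(** Under these conditions the projective map encoded by [(u, v)] is increasing and has no pole on
    [[0, 1]]. *)
Definition positive (u v : rat * rat) : bool :=
  [&& 0 < u.2, 0 < v.2 & u.1 * v.2 < v.1 * u.2].

Lemma vratio_scale2 n v : vratio (scale2 n v) = vratio v.
Proof. by rewrite /vratio /= -mulf_div divff ?mul1r // expfz_neq0. Qed.

Lemma vratio_lt u v : positive u v -> vratio u < vratio v.
Proof.
case/and3P=> u0 v0 h.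
by rewrite /vratio ltr_pdivrMr // mulrAC ltr_pdivlMr.
Qed.

Lemma positive_midl n u v : positive u v -> positive u (mid n u v).
Proof.
case/and3P=> u0 v0 h; have p : 0 < (2 : rat) ^ n by exact: exprz_gt0.
by apply/and3P; split=> //=; nra.
Qed.

Lemma positive_midr n u v : positive u v -> positive (mid n u v) (scale2 n v).
Proof.
case/and3P=> u0 v0 h; have p : 0 < (2 : rat) ^ n by exact: exprz_gt0.
have q := mulr_gt0 p v0.
by apply/and3P; split=> //=; [exact: addr_gt0|nra].
Qed.

Lemma breakpoints_between T u v z : positive u v ->
  z \in breakpoints T u v -> vratio u < z < vratio v.
Proof.
elim: T u v => [//|n l IHl r IHr] u v p /=.
have [pl pr] := (positive_midl n p, positive_midr n p).
have [xw wy] := (vratio_lt pl, vratio_lt pr); rewrite vratio_scale2 in wy.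
rewrite mem_cat inE => /orP[/(IHl _ _ pl)/andP[xz zw]|/orP[/eqP->|]].
- by rewrite xz (lt_trans zw).
- by rewrite xw.
- by move=> /(IHr _ _ pr)/andP[wz]; rewrite vratio_scale2 => ->; rewrite (lt_trans xw).
Qed.

(** The gaps thus depend only on the set of breakpoints, which makes equivalence of trees an
    equality of breakpoint sets. *)
Lemma gapsP T u v a b : positive u v ->
  (a, b) \in gaps T u v <->
  [/\ a < b, a \in vratio u :: breakpoints T u v, b \in vratio v :: breakpoints T u v
    & forall z, a < z -> z < b -> z \notin breakpoints T u v].
Proof.
elim: T u v => [|n l IHl r IHr] u v p /=.
  rewrite !inE xpair_eqE; split=> [/andP[/eqP-> /eqP->]|[_ -> ->]//].
  by rewrite !eqxx vratio_lt.
have [pl pr] := (positive_midl n p, positive_midr n p).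
have [xw wy] := (vratio_lt pl, vratio_lt pr); rewrite vratio_scale2 in wy.
have Bl z := @breakpoints_between l _ _ z pl.
have Br z := @breakpoints_between r _ _ z pr; rewrite vratio_scale2 in Br.
have {}IHl := IHl _ _ pl; have {}IHr := IHr _ _ pr; rewrite vratio_scale2 in IHr.
move: (mid n u v) (scale2 n v) xw wy Bl Br IHl IHr => w v' xw wy Bl Br IHl IHr.
set bl := breakpoints l u w in Bl IHl *.
set br := breakpoints r w v' in Br IHr *.
rewrite mem_cat; split.
  case/orP=> [/IHl|/IHr] [ab]; rewrite !inE => ha hb hz.
    have bw : b <= vratio w by case/orP: hb => [/eqP->//|/Bl/andP[_ /ltW]].
    split=> //; rewrite ?inE ?mem_cat ?inE.
    - by case/orP: ha => ->; rewrite ?orbT.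
    - by case/orP: hb => ->; rewrite ?orbT.
    - move=> z az zb; rewrite mem_cat inE !negb_or hz //=.
      have zw := lt_le_trans zb bw; rewrite (lt_eqF zw) /=.
      by apply/negP => /Br /andP[]; rewrite ltNge (ltW zw).
  have wa : vratio w <= a by case/orP: ha => [/eqP->//|/Br/andP[/ltW]].
  split=> //; rewrite ?inE ?mem_cat ?inE.
  - by case/orP: ha => ->; rewrite ?orbT.
  - by case/orP: hb => ->; rewrite ?orbT.
  - move=> z az zb; rewrite mem_cat inE !negb_or hz //=.
    have wz := le_lt_trans wa az; rewrite (gt_eqF wz) /= andbT.
    by apply/negP => /Bl /andP[_]; rewrite ltNge (ltW wz).
case=> ab; rewrite !inE !mem_cat !inE => ha hb hz.
have hzl z : a < z -> z < b -> z \notin bl.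
  by move=> az zb; have := hz z az zb; rewrite mem_cat negb_or => /andP[].
have hzr z : a < z -> z < b -> z \notin br.
  move=> az zb; have := hz z az zb.
  by rewrite mem_cat inE !negb_or => /and3P[].
(* No breakpoint lies inside a gap, so it is entirely on one side of the root breakpoint. *)
have [wa|aw] := leP (vratio w) a; apply/orP; [right|left].
  have wb := le_lt_trans wa ab.
  apply/IHr; split=> //; rewrite inE.
    case/or4P: ha => [/eqP E|/Bl/andP[_ h]|->//|->]; rewrite ?orbT //.
      by move: wa; rewrite E leNgt xw.
    by move: wa; rewrite leNgt h.
  case/or4P: hb => [->//|/Bl/andP[_ h]|/eqP E|->]; rewrite ?orbT //.
    by move: wb; rewrite ltNge (ltW h).
  by move: wb; rewrite E ltxx.
have bw : b <= vratio w.
  rewrite leNgt; apply/negP => wb.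
  by have := hz _ aw wb; rewrite mem_cat inE eqxx orbT.
apply/IHl; split=> //; rewrite inE.
  case/or4P: ha => [->//|->|/eqP E|/Br/andP[h _]]; rewrite ?orbT //.
    by move: aw; rewrite E ltxx.
  by move: aw; rewrite ltNge (ltW h).
case/or4P: hb => [/eqP E|->|->|/Br/andP[h _]]; rewrite ?orbT //.
  by move: bw; rewrite E leNgt wy.
by move: bw; rewrite leNgt h.
Qed.

Lemma gap_from T u v a :
  a \in vratio u :: breakpoints T u v -> exists b, (a, b) \in gaps T u v.
Proof.
elim: T u v => [|n l IHl r IHr] u v /=.
  by rewrite inE => /eqP ->; exists (vratio v); rewrite inE.
rewrite inE mem_cat inE orbA => /orP[h|h].
  have [|b hb] := IHl u (mid n u v); first by rewrite inE.
  by exists b; rewrite mem_cat hb.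
have [|b hb] := IHr (mid n u v) (scale2 n v); first by rewrite inE.
by exists b; rewrite mem_cat hb orbT.
Qed.

(** * Intervals as images of projective maps *)

Section Intervals.
Variable R : realType.
Implicit Types (u v : rat * rat) (x : R).

Definition proj_map u v x : R :=
  (x * ratr v.1 + (1 - x) * ratr u.1) / (x * ratr v.2 + (1 - x) * ratr u.2).

Lemma proj_den_gt0 u v x : 0 < u.2 -> 0 < v.2 -> unitI x ->
  0 < x * ratr v.2 + (1 - x) * ratr u.2 :> R.
Proof.
move=> u0 v0 /unitIE/andP[x0 x1].
have : 0 < ratr u.2 :> R by rewrite ltr0q.
have : 0 < ratr v.2 :> R by rewrite ltr0q.
by move: (ratr _) (ratr _) => a b a0 b0; nra.
Qed.

Lemma proj_map_image u v : positive u v ->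
  proj_map u v @` unitI = `[ratr (vratio u), ratr (vratio v)[%classic.
Proof.
case/and3P=> u0 v0 h.
rewrite /proj_map /vratio !fmorph_div /=.
have h' : ratr u.1 * ratr v.2 < ratr v.1 * ratr u.2 :> R.
  by rewrite -!rmorphM ltr_rat.
have u0' : 0 < ratr u.2 :> R by rewrite ltr0q.
have v0' : 0 < ratr v.2 :> R by rewrite ltr0q.
move: (ratr u.1) (ratr u.2) (ratr v.1) (ratr v.2) h' u0' v0' => a b c d {}h b0 d0.
apply/seteqP; split=> [y [x /unitIE/andP[x0 x1] <-]|y] /=.
  have p : 0 < x * d + (1 - x) * b by nra.
  rewrite in_itv /=; apply/andP; split.
    by rewrite ler_pdivrMr // mulrAC ler_pdivlMr //; nra.
  by rewrite ltr_pdivrMr // mulrAC ltr_pdivlMr //; nra.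
rewrite in_itv /= => /andP[]; rewrite ler_pdivrMr // ltr_pdivlMr // => h1 h2.
have p : 0 < (y * b - a) + (c - y * d) by lra.
(* The preimage of [y], found by clearing the denominator and solving a linear equation. *)
exists ((y * b - a) / ((y * b - a) + (c - y * d))).
  apply/unitIE; rewrite ler_pdivlMr // ltr_pdivrMr //.
  by apply/andP; split; lra.
have q : c * b - a * d != 0 by rewrite gt_eqF // subr_gt0.
field; rewrite (gt_eqF p) /=.
suff -> : (y * b - a) * d + (y * b - a + (c - y * d) - (y * b - a)) * b =
    c * b - a * d by [].
by ring.
Qed.

Lemma powC_unitI n x : unitI x -> unitI (powC n x).
Proof.
move=> hx; case: n => k /=.
  by elim: k => //= k; exact: mapC_unitI.
by apply: mapCinv_unitI; elim: k => //= k; exact: mapCinv_unitI.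
Qed.

Lemma word_map_unitI (w : seq letter) x : unitI x -> unitI (word_map w x).
Proof.
move=> hx; elim: w => //= a w; case: a => [||n] /= IH; last exact: powC_unitI.
  have /andP[h1 h2] := mapA_unitI IH; apply/unitIE; rewrite h1 /=; lra.
have /andP[h1 h2] := mapB_unitI IH; apply/unitIE; rewrite h2 andbT; lra.
Qed.

(** In the coordinate [t = x / (1 - x)] this is multiplication by [2 ^ n]. *)
Lemma powCE n x : unitI x -> powC n x = 2 ^ n * x / (2 ^ n * x + (1 - x)).
Proof.
move=> hx; have /andP[x0 x1] := (unitIE x).1 hx.
case: n => k.
  rewrite /powC -exprnP; elim: k => [|k /= ->].
    by rewrite /= expr0; field; rewrite gt_eqF //; lra.
  have p : 0 < (2 : R) ^+ k by exact: exprn_gt0.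
  rewrite /mapC exprS; field.
  by apply/andP; split; rewrite gt_eqF //; nra.
rewrite /powC NegzE -exprnN; elim: k.+1 => [|{}k /= ->].
  by rewrite /= expr0 invr1; field; rewrite gt_eqF //; lra.
have p : 0 < (2 : R) ^- k by rewrite invr_gt0 exprn_gt0.
rewrite /mapCinv exprS invfM; move: (2 ^- k) p => t p; field.
by apply/andP; split; rewrite gt_eqF //; nra.
Qed.

Lemma ratr_expz2 n : ratr (2 ^ n) = 2 ^ n :> R.
Proof. by rewrite fmorphXz /= rmorph_nat. Qed.

Lemma proj_map_powC n u v x : 0 < u.2 -> 0 < v.2 -> unitI x ->
  proj_map u v (powC n x) = proj_map u (scale2 n v) x.
Proof.
move=> u0 v0 hx; rewrite powCE // /proj_map /= !rmorphM /= !ratr_expz2.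
have h := proj_den_gt0 u0 v0 hx; have /andP[x0 x1] := (unitIE x).1 hx.
have p : 0 < (2 : R) ^ n by exact: exprz_gt0.
have u0' : 0 < ratr u.2 :> R by rewrite ltr0q.
have v0' : 0 < ratr v.2 :> R by rewrite ltr0q.
move: (2 ^ n) p => t p; have q := mulr_gt0 p v0'; field.
by do ?[apply/andP; split]; rewrite gt_eqF //; nra.
Qed.

Lemma proj_map_A n u v x : 0 < u.2 -> 0 < v.2 -> unitI x ->
  proj_map u v (powC n (mapA x)) = proj_map u (mid n u v) x.
Proof.
move=> u0 v0 hx; have [h0 h1] := andP (mapA_unitI hx).
rewrite proj_map_powC //; last by apply/unitIE; rewrite h0 /=; lra.
rewrite /proj_map /= !rmorphD /= !rmorphM /= !ratr_expz2 /mapA.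
have /andP[x0 x1] := (unitIE x).1 hx.
have p : 0 < (2 : R) ^ n by exact: exprz_gt0.
have u0' : 0 < ratr u.2 :> R by rewrite ltr0q.
have v0' : 0 < ratr v.2 :> R by rewrite ltr0q.
move: (2 ^ n) p => t p; have q := mulr_gt0 p v0'; field.
by do ?[apply/andP; split]; rewrite gt_eqF //; nra.
Qed.

Lemma proj_map_B n u v x : 0 < u.2 -> 0 < v.2 -> unitI x ->
  proj_map u v (powC n (mapB x)) = proj_map (mid n u v) (scale2 n v) x.
Proof.
move=> u0 v0 hx; have [h0 h1] := andP (mapB_unitI hx).
rewrite proj_map_powC //; last by apply/unitIE; rewrite h1 andbT; lra.
rewrite /proj_map /= !rmorphD /= !rmorphM /= !ratr_expz2 /mapB.
have /andP[x0 x1] := (unitIE x).1 hx.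
have p : 0 < (2 : R) ^ n by exact: exprz_gt0.
have u0' : 0 < ratr u.2 :> R by rewrite ltr0q.
have v0' : 0 < ratr v.2 :> R by rewrite ltr0q.
move: (2 ^ n) p => t p; have q := mulr_gt0 p v0'; field.
by do ?[apply/andP; split]; rewrite gt_eqF //; nra.
Qed.

(** General [u] and [v] let the induction absorb the prefix of a word, read from the root, into the
    projective map. *)
Lemma proj_intervals T u v : positive u v ->
  [set (proj_map u v \o word_map w) @` unitI | w in leaf_labels T] =
  [set `[ratr p.1 : R, ratr p.2[%classic | p in [set` gaps T u v]].
Proof.
elim: T u v => [|n l IHl r IHr] u v p.
  apply/seteqP; split=> X /= [w hw <-].
    exists (vratio u, vratio v); first by rewrite inE.
    by rewrite hw /= -proj_map_image.
  exists [::] => //; move: hw; rewrite inE => /eqP -> /=.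
  by rewrite -proj_map_image.
have /and3P[u0 v0 _] := p.
have EA w : (proj_map u v \o word_map [:: LC n, LA & w]) @` unitI =
    (proj_map u (mid n u v) \o word_map w) @` unitI.
  by apply: eq_imagel => x hx /=; rewrite proj_map_A //; exact: word_map_unitI.
have EB w : (proj_map u v \o word_map [:: LC n, LB & w]) @` unitI =
    (proj_map (mid n u v) (scale2 n v) \o word_map w) @` unitI.
  by apply: eq_imagel => x hx /=; rewrite proj_map_B //; exact: word_map_unitI.
have /seteqP[L1 L2] := IHl _ _ (positive_midl n p).
have /seteqP[R1 R2] := IHr _ _ (positive_midr n p).
apply/seteqP; split=> X.
  case=> _ [[w hw <-]|[w hw <-]] <-.
    rewrite EA; have [|q hq <-] := L1 ((proj_map u (mid n u v) \o word_map w) @` unitI).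
      by exists w.
    by exists q => //=; rewrite mem_cat; apply/orP; left.
  rewrite EB; have [|q hq <-] := R1 ((proj_map (mid n u v) (scale2 n v) \o word_map w) @`
      unitI); first by exists w.
  by exists q => //=; rewrite mem_cat; apply/orP; right.
case=> q /= hq <-; move: hq; rewrite mem_cat => /orP[hq|hq].
  have [|w hw <-] := L2 `[ratr q.1 : R, ratr q.2[%classic; first by exists q.
  by exists [:: LC n, LA & w]; rewrite ?EA //; left; exists w.
have [|w hw <-] := R2 `[ratr q.1 : R, ratr q.2[%classic; first by exists q.
by exists [:: LC n, LB & w]; rewrite ?EB //; right; exists w.
Qed.

Definition unit_breakpoints T := breakpoints T (0, 1) (1, 1).

Lemma positive01 : positive (0, 1) (1, 1).
Proof. by []. Qed.

Lemma intervals_gaps T : intervals R T =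
  [set `[ratr p.1 : R, ratr p.2[%classic | p in [set` gaps T (0, 1) (1, 1)]].
Proof.
rewrite -proj_intervals //; apply/seteqP; split=> X [w hw <-];
  exists w => //; apply: eq_imagel => x _ /=;
  rewrite /proj_map /= !rmorph1 rmorph0; field; rewrite gt_eqF //; lra.
Qed.

(** The intervals are closed on the left, so 0 and the breakpoints can be recovered as their
    minima. *)
Lemma unit_breakpoints_intervals T z : (z == 0) || (z \in unit_breakpoints T) <->
  exists X, [/\ intervals R T X, X (ratr z) & forall y, X y -> ratr z <= y].
Proof.
have E : (z == 0) || (z \in unit_breakpoints T) =
    (z \in vratio (0, 1) :: unit_breakpoints T) by rewrite inE.
rewrite E intervals_gaps; split.
  move=> /gap_from[b hb]; exists `[ratr z : R, ratr b[%classic; split.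
  - by exists (z, b).
  - have [zb _ _ _] := (gapsP T z b positive01).1 hb.
    by rewrite /= in_itv /= lexx ltr_rat.
  - by move=> y; rewrite /= in_itv /= => /andP[].
case=> _ [[[a b] hb <-] /=]; rewrite in_itv /= => /andP[az zb] h.
have [ab ha _ _] := (gapsP T a b positive01).1 hb.
suff -> : z = a by [].
apply/eqP; rewrite eq_le -!(ler_rat R) az andbT; apply: h.
by rewrite /= in_itv /= lexx ltr_rat.
Qed.

Lemma tree_equivP T T' : tree_equiv R T T' <-> unit_breakpoints T =i unit_breakpoints T'.
Proof.
have ng S z : z \in unit_breakpoints S -> z != 0.
  by move=> /(breakpoints_between positive01)/andP[h _]; rewrite gt_eqF.
split=> [E z|E].
  have H : (z == 0) || (z \in unit_breakpoints T) <-> (z == 0) || (z \in unit_breakpoints T').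
    by rewrite !unit_breakpoints_intervals E.
  apply/idP/idP => h.
    by have /orP[/eqP z0|//] := H.1 (introT orP (or_intror h));
      move: (ng _ _ h); rewrite z0.
  by have /orP[/eqP z0|//] := H.2 (introT orP (or_intror h));
    move: (ng _ _ h); rewrite z0.
rewrite /tree_equiv !intervals_gaps.
have H a b : (a, b) \in gaps T (0, 1) (1, 1) <-> (a, b) \in gaps T' (0, 1) (1, 1).
  rewrite !(gapsP _ _ _ positive01) -!/(unit_breakpoints _) !inE !E.
  by split=> -[? ? ? h]; split=> // z az zb; have := h z az zb; rewrite E.
by apply/seteqP; split=> X [[a b] /= /H h <-]; exists (a, b).
Qed.

(** The root power of [mapC] is applied last, so a shift of the root label moves all intervals by
    one map; this reduces an intermediate label to 0. *)
Lemma intervals_shift n k l r : intervals R (Node (n + k) l r) =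
  [set powC k @` X | X in intervals R (Node n l r)].
Proof.
have D (x : R) : unitI x -> powC (n + k) x = powC k (powC n x).
  move=> hx; have hn := powC_unitI n hx.
  rewrite (powCE _ hx) (powCE _ hn) (powCE _ hx).
  have /andP[x0 x1] := (unitIE x).1 hx.
  rewrite expfzDr ?pnatr_eq0 //; move: (exprz_gt0 n (ltr0n R 2)) (exprz_gt0 k (ltr0n R 2)).
  move: (2 ^ n) (2 ^ k) => s t s0 t0.
  have sx := mulr_ge0 (ltW s0) x0; have tsx := mulr_ge0 (ltW t0) sx; field.
  by do ?[apply/andP; split]; rewrite gt_eqF //; nra.
have E a w : word_map [:: LC (n + k), a & w] @` unitI =
    powC k @` (word_map [:: LC n, a & w] @` unitI) :> set R.
  rewrite image_comp; apply: eq_imagel => x hx.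
  by rewrite /= D //; exact: (word_map_unitI (a :: w)).
apply/seteqP; split=> X.
  case=> _ [[w hw <-]|[w hw <-]] <-; rewrite E; eexists=> //.
    by exists [:: LC n, LA & w] => //; left; exists w.
  by exists [:: LC n, LB & w] => //; right; exists w.
case=> _ [_ [[w hw <-]|[w hw <-]] <-] <-; rewrite -E.
  by exists [:: LC (n + k), LA & w] => //; left; exists w.
by exists [:: LC (n + k), LB & w] => //; right; exists w.
Qed.

Lemma tree_equiv_shift n n' k l r l' r' :
  tree_equiv R (Node n l r) (Node n' l' r') ->
  tree_equiv R (Node (n + k) l r) (Node (n' + k) l' r').
Proof. by rewrite /tree_equiv !intervals_shift => ->. Qed.

End Intervals.

(** * Passage between trees and triangulations *)

(* [u] is a multiple by a power of 2 of the primitive integral vector of [x]. *)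
Definition scaled (x : rat) (u : rat * rat) : Prop :=
  exists i : int, u = (2 ^ i * (numq x)%:~R, 2 ^ i * (denq x)%:~R).

Lemma expz2_gt0 (n : int) : 0 < (2 : rat) ^ n.
Proof. exact: exprz_gt0. Qed.

Lemma scaled_scale2 n x u : scaled x u -> scaled x (scale2 n u).
Proof.
by case=> i ->; exists (n + i); rewrite /scale2 /= expfzDr // !mulrA.
Qed.

Lemma scaled_vratio x u : scaled x u -> vratio u = x.
Proof.
case=> i ->; rewrite /vratio /= -mulf_div divff ?mul1r ?divq_num_den //.
by rewrite gt_eqF ?expz2_gt0.
Qed.

Lemma scaled_positive x y u v : scaled x u -> scaled y v -> x < y ->
  positive u v.
Proof.
move=> [i ->] [j ->]; rewrite -fdet_gt0 /fdet subr_gt0 => h.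
apply/and3P; split => /=; try by rewrite mulr_gt0 ?expz2_gt0 ?ltr0z.
rewrite mulrACA [ltRHS]mulrACA [2 ^ j * _]mulrC ltr_pM2l ?mulr_gt0 ?expz2_gt0 //.
by rewrite -!intrM ltr_int.
Qed.

Lemma pow2_factor (s t : int) k : 0 < s -> s * t = 2 ^+ k ->
  exists i, s = 2 ^+ i.
Proof.
move=> s0 e; have : (`|s| %| 2 ^ k)%N.
  have -> : (2 ^ k)%N = `|(s * t)%R|%N by rewrite e abszX.
  by rewrite abszM dvdn_mulr.
case/(dvdn_pfactor _ _ (isT : prime 2)) => i _ e'; exists i.
by rewrite -[LHS]gtr0_norm // -abszE e' -natz natrX.
Qed.

(** Up to a power of 2, [w] is an integral vector [(A, B)], which is [S] times the primitive vector
    of its ratio. Its determinants with [x] and [y] are powers of 2 divisible by [S], so [S] and the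
    cofactors are powers of 2. *)
Lemma scaled_mid n x y u v (w := mid n u v) : scaled x u -> scaled y v ->
  edge x y -> [/\ scaled (vratio w) w, edge x (vratio w) & edge (vratio w) y].
Proof.
move=> [i eu] [j ev] [k exy].
(* A common power of 2 is split off to leave natural exponents. *)
have [e [a [b [ei ej]]]] : exists (e : int) (a b : nat), i = e + a /\ n + j = e + b.
  pose N := (`|i| + `|(n + j)%R|)%N.
  exists (- N%:Z), `|(i + N%:Z)%R|%N, `|(n + j + N%:Z)%R|%N.
  by rewrite /N; split; lia.
pose A := 2 ^+ a * numq x + 2 ^+ b * numq y.
pose B := 2 ^+ a * denq x + 2 ^+ b * denq y.
have B_gt0 : 0 < B by rewrite addr_gt0 ?mulr_gt0 ?exprn_gt0.
have ew : w = (2 ^ e * A%:~R, 2 ^ e * B%:~R).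
  rewrite /w /mid eu ev /= !mulrA -!expfzDr // ei ej !expfzDr //.
  by rewrite !rmorphD !rmorphM !rmorphXn /= !mulrDr !mulrA.
set z := vratio w.
have ez : z = A%:~R / B%:~R.
  by rewrite /z /vratio ew /= -mulf_div divff ?mul1r // gt_eqF ?expz2_gt0.
have cross : numq z * B = A * denq z.
  have zB : z * B%:~R = A%:~R by rewrite ez divfK // intr_eq0 gt_eqF.
  by apply/eqP; rewrite -(eqr_int rat) !intrM numqE mulrAC zB.
have /dvdzP[S eB] : (denq z %| B)%Z.
  have : (denq z %| numq z * B)%Z by rewrite cross dvdz_mull.
  by rewrite Gauss_dvdzr // coprimez_sym; exact: coprime_num_den.
have eA : A = S * numq z.
  apply: (mulIf (denq_neq0 z)); rewrite -cross eB; ring.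
have S_gt0 : 0 < S by move: B_gt0; rewrite eB pmulr_lgt0.
have f1 : S * fdet x z = 2 ^+ (b + k).
  rewrite exprD -exy /fdet.
  transitivity (S * numq z * denq x - numq x * (S * denq z)); first by ring.
  by rewrite -eA -eB /A /B; ring.
have f2 : S * fdet z y = 2 ^+ (a + k).
  rewrite exprD -exy /fdet.
  transitivity (numq y * (S * denq z) - S * numq z * denq y); first by ring.
  by rewrite -eA -eB /A /B; ring.
have gt0 t m : S * t = 2 ^+ m -> 0 < t.
  by move=> E; rewrite -(pmulr_rgt0 _ S_gt0) E exprn_gt0.
split.
- have [s es] := pow2_factor S_gt0 f1; exists (e + s).
  by rewrite ew eA eB es expfzDr // !rmorphM !rmorphXn /= !mulrA.
- by apply: (pow2_factor (gt0 _ _ f1)); rewrite mulrC; exact: f1.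
- by apply: (pow2_factor (gt0 _ _ f2)); rewrite mulrC; exact: f2.
Qed.

(** By Cramer's rule, [2 ^+ k] times the vector of [z] is [2 ^+ i] times that of [x] plus [2 ^+ j]
    times that of [y]. The label is [j - i], corrected by the scalings of [u] and [v]. *)
Lemma mid_of_edges x y z u v : scaled x u -> scaled y v ->
  edge x z -> edge z y -> edge x y -> exists n, scaled z (mid n u v).
Proof.
move=> [a ->] [b ->] [j ej] [i ei] [k ek].
exists (j%:Z - i%:Z + a - b), (a - i%:Z + k%:Z); rewrite /mid /=.
have cramer1 : fdet x y * numq z = fdet z y * numq x + fdet x z * numq y.
  by rewrite /fdet; ring.
have cramer2 : fdet x y * denq z = fdet z y * denq x + fdet x z * denq y.
  by rewrite /fdet; ring.
have E (p q r : int) : fdet x y * r = fdet z y * p + fdet x z * q ->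
    2 ^ a * p%:~R + 2 ^ (j%:Z - i%:Z + a - b) * (2 ^ b * q%:~R) =
    2 ^ (a - i%:Z + k%:Z) * r%:~R :> rat.
  rewrite ej ei ek => /(congr1 (fun t : int => t%:~R : rat)).
  rewrite rmorphD !rmorphM !rmorphXn /= => h.
  rewrite mulrA -expfzDr // subrK !expfzDr // -!exprnN -!exprnP.
  rewrite -[X in _ = X]mulrA h; have : (2 : rat) ^+ i != 0 by exact: expf_neq0.
  by move: (2 ^ a) (2 ^+ i) (2 ^+ j) => s t t' t0; field.
by rewrite (E _ _ _ cramer1) (E _ _ _ cramer2).
Qed.

Lemma mem_breakpoints_node n l r u v z (w := mid n u v) : positive u v ->
  (z \in breakpoints (Node n l r) u v) =
  if z < vratio w then z \in breakpoints l u w else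
  (z == vratio w) || (z \in breakpoints r w (scale2 n v)).
Proof.
move=> p; rewrite /= -/w mem_cat inE.
have [zw|wz] := ltP z (vratio w).
  rewrite (lt_eqF zw) /=; case: (boolP (z \in breakpoints r _ _)); last by rewrite orbF.
  move=> /(breakpoints_between (positive_midr n p))/andP[h _].
  by have := lt_trans h zw; rewrite ltxx.
case: (boolP (z \in breakpoints l _ _)) => //.
move=> /(breakpoints_between (positive_midl n p))/andP[_ h].
by have := lt_le_trans h wz; rewrite ltxx.
Qed.

Lemma triangulated_breakpoints (P : pred rat) T u v x y :
  scaled x u -> scaled y v -> edge x y ->
  (forall z, x < z -> z < y -> P z = (z \in breakpoints T u v)) ->
  triangulated P x y.
Proof.
elim: T u v x y => [|n l IHl r IHr] u v x y su sv exy H.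
  by apply: triangulated_side => z xz zy; rewrite H.
have p := scaled_positive su sv (edge_lt exy).
have [sw xw wy] := scaled_mid n su sv exy.
have [ltxw ltwy] := (edge_lt xw, edge_lt wy).
apply: (@triangulated_apex _ _ (vratio (mid n u v))) => //.
- by rewrite H // mem_breakpoints_node // ltxx eqxx.
- apply: (IHl u (mid n u v)) => // z xz zw.
  by rewrite H ?(lt_trans zw) // mem_breakpoints_node // zw.
- apply: (IHr (mid n u v) (scale2 n v)) => //; first exact: scaled_scale2.
  move=> z wz zy; rewrite H ?(lt_trans ltxw) // mem_breakpoints_node //.
  by rewrite ltNge (ltW wz) /= gt_eqF.
Qed.

(** The vectors stay arbitrary in the conclusion because the label chosen at an apex determines the
    scalings passed to the subtrees. *)
Lemma tree_of_triangulated (P : pred rat) x y : triangulated P x y ->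
  forall u v, scaled x u -> scaled y v -> edge x y ->
  exists T, forall z, x < z -> z < y -> P z = (z \in breakpoints T u v).
Proof.
elim=> {x y} [x y H|x w y Pw xw wy _ IHl _ IHr] u v su sv exy.
  by exists Leaf => z xz zy; apply/negbTE/H.
have [n sw] := mid_of_edges su sv xw wy exy.
have [l Hl] := IHl _ _ su sw xw.
have [r Hr] := IHr _ _ sw (scaled_scale2 n sv) wy.
have p := scaled_positive su sv (edge_lt exy).
exists (Node n l r) => z xz zy; rewrite mem_breakpoints_node // (scaled_vratio sw).
have [zw|wz|->] := ltgtP z w; first exact: Hl; last exact: Pw.
exact: Hr.
Qed.

(** * Root triangles and convexity of the root labels *)

Definition apex (n : int) : rat := vratio (mid n (0, 1) (1, 1)).

(** This is the point with coordinate [t = 2 ^ n]. *)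
Lemma apexE n : apex n = 2 ^ n / (1 + 2 ^ n).
Proof. by rewrite /apex /vratio /= add0r mulr1. Qed.

Lemma apex_inj : injective apex.
Proof.
move=> n m; rewrite !apexE => /eqP.
have [pn pm] := (expz2_gt0 n, expz2_gt0 m).
rewrite eqr_div; try by rewrite gt_eqF ?addr_gt0.
move=> /eqP e.
have /(ieexprIz (isT : 0 < 2 :> rat)) : (2 : rat) ^ n = 2 ^ m by lra.
exact.
Qed.

(** The numerator is 1 for [n <= 0] and the even number [2 ^ n] otherwise. *)
Lemma colour_apex n : colour (apex n) = (n <= 0).
Proof.
have E (a b : nat) : coprime a b -> (0 < b)%N ->
    colour (a%:R / b%:R) = odd a.
  move=> cab b0; rewrite /colour -[a%:R]/(a%:Z%:~R) -[b%:R]/(b%:Z%:~R).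
  by rewrite coprimeq_num //= gtr0_sg // mul1r.
rewrite apexE; case: n => k; last first.
  rewrite NegzE -exprnN.
  have -> : (2 : rat) ^- k.+1 / (1 + 2 ^- k.+1) = 1%:R / (2 ^ k.+1 + 1)%:R.
    rewrite natrD natrX; field.
    by rewrite !expf_neq0 //= gt_eqF // addr_gt0 // exprn_gt0.
  by rewrite E // ?coprime1n // addn1.
rewrite -exprnP.
have -> : (2 : rat) ^+ k / (1 + 2 ^+ k) = (2 ^ k)%:R / (1 + 2 ^ k)%:R.
  by rewrite natrD natrX.
have cop : coprime (2 ^ k) (1 + 2 ^ k) by rewrite /coprime gcdnDr gcdn1.
by rewrite (E _ _ cop) // oddX orbF; case: k {cop}.
Qed.

Lemma scaled0 : scaled 0 (0, 1).
Proof. by exists 0. Qed.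

Lemma scaled1 : scaled 1 (1, 1).
Proof. by exists 0. Qed.

Lemma edge01 : edge 0 1.
Proof. by exists 0%N. Qed.

(** The two root triangles have different majority colours, so [mediant_apex] gives a triangulation
    through the mediant 1/2, which is [apex 0]; it is then read back as a tree. *)
Lemma root_label0 (R : realType) (n n' : int) l r l' r' : n <= 0 -> 1 <= n' ->
  tree_equiv R (Node n l r) (Node n' l' r') ->
  exists l'' r'', tree_equiv R (Node 0 l'' r'') (Node n l r).
Proof.
move=> n0 n1 /tree_equivP E.
(* The points 0 and 1 are included because sides of chains join points of [P]. *)
pose P := [pred z : rat | [|| z \in unit_breakpoints (Node n l r), z == 0 | z == 1]].
have HP (z : rat) : 0 < z -> z < 1 -> P z = (z \in unit_breakpoints (Node n l r)).
  by move=> z0 z1; rewrite /P /= (gt_eqF z0) (lt_eqF z1) !orbF.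
have root_triangle T : (forall z, 0 < z -> z < 1 -> P z = (z \in unit_breakpoints T)) ->
    forall m s t, T = Node m s t -> [/\ P (apex m), edge 0 (apex m),
      edge (apex m) 1, triangulated P 0 (apex m) & triangulated P (apex m) 1].
  move=> H m s t e; subst T.
  have [sw xw wy] := scaled_mid m scaled0 scaled1 edge01.
  have [ltxw ltwy] := (edge_lt xw, edge_lt wy).
  split=> //.
  - by rewrite H // /unit_breakpoints mem_breakpoints_node // ltxx eqxx.
  - apply: (triangulated_breakpoints (T := s) scaled0 sw xw) => z xz zw.
    by rewrite H ?(lt_trans zw) // /unit_breakpoints mem_breakpoints_node // zw.
  - apply: (triangulated_breakpoints (T := t) sw (scaled_scale2 m scaled1) wy).
    move=> z wz zy; rewrite H ?(lt_trans ltxw) // /unit_breakpoints mem_breakpoints_node //.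
    by rewrite ltNge (ltW wz) /= gt_eqF.
have [v1 v2 v3 v4 v5] := root_triangle _ HP _ _ _ erefl.
have [|u1 u2 u3 u4 u5] := root_triangle (Node n' l' r') _ _ _ _ erefl.
  by move=> z z0 z1; rewrite HP // E.
have [Pw tl tr] : [/\ P (1 / 2), triangulated P 0 (1 / 2) & triangulated P (1 / 2) 1].
  (* The numerators of 0 and [apex n'] are even, those of 1 and [apex n] odd. *)
  apply: (@mediant_apex P 0 1 (apex n') (apex n)) => //; rewrite ?colour_apex //.
  - by rewrite /P /= orbT.
  - by rewrite /P /= orbT.
  - by rewrite lt_geF // (lt_le_trans ltr01 n1).
(* The vector [(1, 2)] is [mid 0 (0, 1) (1, 1)]. *)
have [||ll Hl] := tree_of_triangulated tl scaled0 (_ : scaled _ (1, 2)).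
- by exists 0.
- by exists 0%N.
have [||rr Hr] := tree_of_triangulated tr (_ : scaled _ (1, 2)) scaled1.
- by exists 0.
- by exists 0%N.
exists ll, rr; apply/tree_equivP => z.
have [z0|z0] := ltP 0 z; last first.
  have N T : z \notin unit_breakpoints T.
    by apply/negP => /(breakpoints_between positive01)/andP[]; rewrite ltNge z0.
  by rewrite !(negbTE (N _)).
have [z1|z1] := ltP z 1; last first.
  have N T : z \notin unit_breakpoints T.
    by apply/negP => /(breakpoints_between positive01)/andP[_]; rewrite ltNge z1.
  by rewrite !(negbTE (N _)).
rewrite -HP // [LHS]mem_breakpoints_node //.
have -> : mid 0 (0, 1) (1, 1) = (1, 2) by [].
have -> : scale2 0 (1, 1) = (1, 1) by [].
have -> : vratio (1, 2) = 1 / 2 by [].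
have [zw|wz|->] := ltgtP z (1 / 2); last by rewrite Pw.
- by rewrite Hl.
- by rewrite Hr.
Qed.

(** A shift by [- k] makes the first label at most 0 and, unless [k = b], the second at least 1; the
    label 0 found there is shifted back to [k]. *)
Lemma root_labels_convex (R : realType) T a b k :
  root_labels R T a -> root_labels R T b -> a <= k <= b -> root_labels R T k.
Proof.
case=> -[[]//|n l r [Ea [na]]] [[[]//|m l' r' [Eb [mb]]]] /andP[ak kb].
subst n m; move: kb; rewrite le_eqVlt => /orP[/eqP ->|kb].
  by exists (Node b l' r').
have Eab : tree_equiv R (Node a l r) (Node b l' r') by rewrite /tree_equiv Ea.
have [||l'' [r'']] := root_label0 _ _ (tree_equiv_shift (- k) Eab).
- by rewrite subr_le0.
- by rewrite lerBrDl; lia.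
move=> /(tree_equiv_shift k); rewrite add0r subrK => Ek.
by exists (Node k l'' r''); split=> //; rewrite /tree_equiv Ek.
Qed.

(** * Boundedness and extremal labels *)

(** Distinct labels give distinct breakpoints of [T], of which there are finitely many. *)
Lemma root_labels_bounded (R : realType) T :
  exists B : nat, forall n, root_labels R T n -> - B%:Z <= n <= B%:Z.
Proof.
have H n : root_labels R T n -> apex n \in unit_breakpoints T.
  case=> -[[]//|m l r [/tree_equivP E [mn]]]; subst m.
  by rewrite -E /unit_breakpoints /= mem_cat mem_head orbT.
have [B HB] : exists B : nat,
    forall n, apex n \in unit_breakpoints T -> - B%:Z <= n <= B%:Z.
  elim: (unit_breakpoints T) => [|h s [B IH]]; first by exists 0%N.
  have [[m hm]|no] := pselect (exists m, apex m = h).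
    exists (maxn B `|m|) => n; rewrite inE => /orP[/eqP|/IH]; last by lia.
    by rewrite -hm => /apex_inj ->; lia.
  by exists B => n; rewrite inE => /orP[/eqP e|/IH//]; case: no; exists n.
by exists B => n /H/HB.
Qed.

Lemma bounded_set_max (S : set int) (n0 : int) (B : nat) :
  S n0 -> (forall n, S n -> - B%:Z <= n <= B%:Z) -> exists M, is_max S M.
Proof.
move=> S0 SB.
(* Shifted by [B], the set consists of natural numbers up to [2 * B]. *)
have ex : exists k : nat, `[< S (k%:Z - B%:Z) >].
  exists `|(n0 + B%:Z)%R|%N; apply/asboolP.
  by have := SB _ S0 => /andP[h _]; rewrite gez0_abs ?addrK //; lia.
have bd k : `[< S (k%:Z - B%:Z) >] -> (k <= 2 * B)%N.
  by move=> /asboolP/SB; lia.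
have [M /asboolP SM HM] := ex_maxnP ex bd.
exists (M%:Z - B%:Z); split=> // n Sn; have /andP[h _] := SB _ Sn.
have := HM `|(n + B%:Z)%R|%N; rewrite gez0_abs ?addrK; last by lia.
by move=> /(_ (asboolT Sn)); lia.
Qed.

Lemma bounded_set_min (S : set int) (n0 : int) (B : nat) :
  S n0 -> (forall n, S n -> - B%:Z <= n <= B%:Z) -> exists m, is_min S m.
Proof.
move=> S0 SB.
have [||M [SM HM]] := @bounded_set_max [set n | S (- n)] (- n0) B.
- by rewrite /= opprK.
- by move=> n /SB; lia.
exists (- M); split=> // n Sn; rewrite lerNl; apply: HM; by rewrite /= opprK.
Qed.

Theorem theorem8p5 (R : realType) (T : subdivision_tree) (hT : T <> Leaf) :
  exists m M : int,
    [/\ is_min (root_labels R T) m,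
        is_max (root_labels R T) M &
        root_labels R T = [set n : int | m <= n <= M]].
Proof.
have [n Sn] : exists n, root_labels R T n.
  by case: T hT => // n l r _; exists n, (Node n l r).
have [B SB] := root_labels_bounded R T.
have [m [Sm minm]] := bounded_set_min Sn SB.
have [M [SM maxM]] := bounded_set_max Sn SB.
exists m, M; split=> //; apply/seteqP; split=> k /=.
  by move=> Sk; rewrite minm ?maxM.
exact: root_labels_convex.
Qed.
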